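(* Let $x_1, x_2, x_3, \ldots$ be indeterminates. Then, as formal power series, $$\sum_{\pi \in I(3412)} \prod_{k \ge 1} x_k^{\tau_k(\pi)} = \cfrac{1}{1-x_1 - \cfrac{x_1^2 x_2}{1 - x_1 x_2^2 x_3 - \cfrac{x_1^2 x_2^5 x_3^4 x_4}{1 - x_1 x_2^4 x_3^6 x_4^4 x_5 - \cdots}}},$$ where the continued fraction on the right has the form $\cfrac{1}{b_0 - \cfrac{a_1}{b_1 - \cfrac{a_2}{b_2 - \cdots}}}$ with $b_0 = 1 - x_1$ and, for all $n \ge 1$, $$a_n = \prod_{i=1}^{2n} x_i^{\binom{2n-2}{i-1} + \binom{2n-1}{i-1}}, \qquad b_n = 1 - \prod_{i=1}^{2n+1} x_i^{\binom{2n}{i-1}}.$$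
   Context: Permutations of $\{1,\ldots,n\}$ are written in one-line notation. A permutation $\pi$ avoids a permutation $\sigma$ if no subsequence of $\pi$ has the same pairwise comparisons (the same relative order) as $\sigma$. $I(3412)$ denotes the set of all involutions (of all lengths $n \ge 0$, including the empty permutation) which avoid $3412$. For a positive integer $k$ and a permutation $\pi$, $\tau_k(\pi)$ is the number of decreasing subsequences of length $k$ in $\pi$. The convention $\binom{n}{k} = 0$ for $k<0$ or $k>n$ is used. The infinite continued fraction is the formal-power-series limit of its finite truncations. *)

(* Defs.v *)
From HB Require Import structures.
From mathcomp Require Import all_boot all_order all_algebra all_fingroup.
From mathcomp Require Import finmap boolp.
From mathcomp Require Import monalg.

Set Implicit Arguments.
Unset Strict Implicit.
Unset Printing Implicit Defensive.

Import GRing.Theory.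
Local Open Scope ring_scope.

Local Notation "1" := (@mone _) : monom_scope.
Local Notation "x * y" := (mmul x y) : monom_scope.

(* The duplicate-free list of all pairs (m1, m2) of monomials such that       *)
(* m1 * m2 = m; see mem_mfactors and mfactors_uniq.                           *)
Section Factorizations.
Variable I : choiceType.
Implicit Types (m d : {cmonom I}) (p : {cmonom I} * {cmonom I}).

Definition mfactors m : seq ({cmonom I} * {cmonom I}) :=
  undup [seq p <- [seq (d, divcm m d) | d <-
      [seq [cmonom (nat_of_ord (f i)) | i : finsupp m]%M
         | f : {ffun finsupp m -> 'I_(mdeg m).+1}]]
    | (p.1 * p.2)%M == m].

Lemma mfactors_uniq m : uniq (mfactors m).
Proof. exact: undup_uniq. Qed.

Lemma leq_mdeg m i : (m i <= mdeg m)%N.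
Proof.
case: mdomP => // im; rewrite mdegE (big_fsetD1 i) //=; exact: leq_addr.
Qed.

Lemma mem_mfactors m p : (p \in mfactors m) = ((p.1 * p.2)%M == m).
Proof.
rewrite /mfactors mem_undup mem_filter andb_idr // => /eqP mE.
case: p mE => d e /= mE.
have eE : e = divcm m d.
  by apply/eqP/cmP => i; rewrite divcmE -mE cmM addKn.
rewrite eE; apply: map_f; apply/imageP.
pose f := [ffun i : finsupp m => inord (d (val i)) : 'I_(mdeg m).+1].
exists f => //; apply/eqP/cmP => i; rewrite cmE fsfun_ffun.
case: insubP => [u im iE|]; last first.
  have miE : m i = (d i + e i)%N by rewrite -mE cmM.
  by rewrite -cmE_eq0 miE addn_eq0 => /andP[/eqP].
rewrite /= ffunE iE inordK // ltnS (leq_trans _ (leq_mdeg m i)) //.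
by rewrite -mE cmM leq_addr.
Qed.

End Factorizations.

(* Formal power series over R in the indeterminates indexed by I (possibly    *)
(* infinite): arbitrary R-valued functions on the finite-support monomials.   *)
Record fps (I : choiceType) (R : Type) :=
  FPS { fps_coef : {cmonom I} -> R }.

HB.instance Definition _ (I : choiceType) (R : Type) :=
  gen_eqMixin (fps I R).
HB.instance Definition _ (I : choiceType) (R : Type) :=
  gen_choiceMixin (fps I R).

Lemma fpsP (I : choiceType) (R : Type) (f g : fps I R) :
  (forall m, fps_coef f m = fps_coef g m) <-> f = g.
Proof.
split=> [fg|-> //]; case: f g fg => [f] [g] /= fg.
by congr FPS; apply/funext.
Qed.

Section FpsZmodule.
Variables (I : choiceType) (R : zmodType).
Implicit Types f g : fps I R.

Definition fps_zero : fps I R := FPS (fun=> 0).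
Definition fps_opp f : fps I R := FPS (fun m => - fps_coef f m).
Definition fps_add f g : fps I R := FPS (fun m => fps_coef f m + fps_coef g m).

Fact fps_addA : associative fps_add.
Proof. by move=> f g h; apply/fpsP => m /=; rewrite addrA. Qed.

Fact fps_addC : commutative fps_add.
Proof. by move=> f g; apply/fpsP => m /=; rewrite addrC. Qed.

Fact fps_add0 : left_id fps_zero fps_add.
Proof. by move=> f; apply/fpsP => m /=; rewrite add0r. Qed.

Fact fps_addN : left_inverse fps_zero fps_opp fps_add.
Proof. by move=> f; apply/fpsP => m /=; rewrite addNr. Qed.

HB.instance Definition _ := GRing.isZmodule.Build (fps I R)
  fps_addA fps_addC fps_add0 fps_addN.

End FpsZmodule.

Section FpsRing.
Variables (I : choiceType) (R : comNzRingType).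
Implicit Types (f g h : fps I R) (m : {cmonom I}).

Definition fps_one : fps I R := FPS (fun m => (m == 1%M)%:R).

Definition fps_mul f g : fps I R :=
  FPS (fun m => \sum_(p <- mfactors m) fps_coef f p.1 * fps_coef g p.2).

Fact fps_mulC : commutative fps_mul.
Proof.
move=> f g; apply/fpsP => m /=.
pose sw (p : {cmonom I} * {cmonom I}) := (p.2, p.1).
have swK : involutive sw by case.
have pE : perm_eq (mfactors m) (map sw (mfactors m)).
  apply: uniq_perm; rewrite ?(map_inj_uniq (inv_inj swK)) ?mfactors_uniq //.
  move=> p; rewrite -{2}[p]swK (mem_map (inv_inj swK)) !mem_mfactors /=.
  by rewrite mulmC.
by rewrite (perm_big _ pE) big_map; apply: eq_bigr => p _ /=; rewrite mulrC.
Qed.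

Fact fps_mulDl : left_distributive fps_mul (@fps_add I R).
Proof.
move=> f g h; apply/fpsP => m /=; rewrite -big_split /=.
by apply: eq_bigr => p _; rewrite mulrDl.
Qed.

Fact fps_mul1 : left_id fps_one fps_mul.
Proof.
move=> f; apply/fpsP => m /=.
have mF : (1%M, m) \in mfactors m by rewrite mem_mfactors /= mul1m.
rewrite (bigD1_seq _ mF (mfactors_uniq m)) /= eqxx mul1r.
rewrite big_seq_cond big1 ?addr0 // => -[d e] /andP[].
rewrite mem_mfactors /= => /eqP deE.
have [d1|_] := eqVneq d 1%M; last by rewrite mul0r.
by rewrite -deE d1 mul1m eqxx.
Qed.

Fact fps_mulA : associative fps_mul.
Proof.
move=> f g h; apply/fpsP => m /=.
pose T := ({cmonom I} * {cmonom I} * {cmonom I})%type.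
pose F (t : T) := fps_coef f t.1.1 * fps_coef g t.1.2 * fps_coef h t.2.
pose L1 : seq T := [seq (p.1, q.1, q.2) | p <- mfactors m, q <- mfactors p.2].
pose L2 : seq T := [seq (q.1, q.2, p.2) | p <- mfactors m, q <- mfactors p.1].
transitivity (\sum_(t <- L1) F t).
  rewrite /L1 big_allpairs_dep; apply: eq_bigr => p _.
  by rewrite mulr_sumr; apply: eq_bigr => q _; rewrite /F mulrA.
transitivity (\sum_(t <- L2) F t); last first.
  rewrite /L2 big_allpairs_dep; apply: eq_bigr => p _.
  by rewrite mulr_suml.
apply: perm_big; apply: uniq_perm.
- apply: allpairs_uniq_dep => [|p _|t t']; rewrite ?mfactors_uniq //.
  move=> /allpairsPdep[[a b] [[c d] [_ cd ->]]].
  move=> /allpairsPdep[[a' b'] [[c' d'] [_ cd' ->]]] /= [aE cE dE].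
  move: cd cd'; rewrite !mem_mfactors /= => /eqP <- /eqP <-.
  by rewrite aE cE dE.
- apply: allpairs_uniq_dep => [|p _|t t']; rewrite ?mfactors_uniq //.
  move=> /allpairsPdep[[a b] [[c d] [_ cd ->]]].
  move=> /allpairsPdep[[a' b'] [[c' d'] [_ cd' ->]]] /= [aE cE dE].
  move: cd cd'; rewrite !mem_mfactors /= => /eqP <- /eqP <-.
  by rewrite aE cE dE.
move=> [[a b] c]; apply/allpairsPdep/allpairsPdep.
- move=> [[d e][[d' e'][]]]; rewrite !mem_mfactors /=.
  move=> /eqP <- /eqP <- [-> -> ->].
  by exists ((d * d')%M, e'), (d, d'); rewrite !mem_mfactors /= mulmA.
- move=> [[d e][[d' e'][]]]; rewrite !mem_mfactors /=.
  move=> /eqP <- /eqP <- [-> -> ->].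
  by exists (d', (e' * e)%M), (e', e); rewrite !mem_mfactors /= mulmA.
Qed.

Fact fps_one_neq0 : fps_one != 0.
Proof.
apply/eqP => /(congr1 (fun f => fps_coef f 1%M)) /= /eqP.
by rewrite eqxx oner_eq0.
Qed.

HB.instance Definition _ := GRing.Zmodule_isComNzRing.Build (fps I R)
  fps_mulA fps_mulC fps_mul1 fps_mulDl fps_one_neq0.

Definition fps_unit : {pred fps I R} := [pred f | `[< exists g, g * f = 1 >]].

(* The multiplicative inverse, when there is one (and f itself otherwise).    *)
Definition fps_inv f : fps I R :=
  if pselect (exists g, g * f = 1) is left ex then projT1 (cid ex) else f.

Fact fps_mulV : {in fps_unit, left_inverse 1 fps_inv *%R}.
Proof.
move=> f /asboolP ex; rewrite /fps_inv.
by case: pselect => // ex'; exact: projT2 (cid ex').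
Qed.

Fact fps_unitPl f g : g * f = 1 -> fps_unit f.
Proof. by move=> gf; apply/asboolP; exists g. Qed.

Fact fps_invr_out : {in [predC fps_unit], fps_inv =1 id}.
Proof.
move=> f /asboolP nex; rewrite /fps_inv.
by case: pselect => // ex'; case: nex.
Qed.

HB.instance Definition _ := GRing.ComNzRing_hasMulInverse.Build (fps I R)
  fps_mulV fps_unitPl fps_invr_out.

Definition fps_var (i : I) : fps I R := FPS (fun m => (m == ucm i)%:R).

End FpsRing.

Section FpsLimits.
Variables (I : choiceType) (R : comNzRingType).

Definition fps_cvg (u : nat -> fps I R) (S : fps I R) :=
  forall m, exists N0, forall N, (N0 <= N)%N ->
    fps_coef (u N) m = fps_coef S m.

(* The family F is summable over A with sum S: for each monomial m, only      *)
(* finitely many members have a nonzero m-th coefficient, and these add up to *)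
(* the m-th coefficient of S.                                                 *)
Definition fps_has_sum (T : eqType) (A : {pred T}) (F : T -> fps I R)
    (S : fps I R) :=
  forall m, exists s : seq T,
    [/\ uniq s, {subset s <= A},
        {in A, forall t, t \notin s -> fps_coef (F t) m = 0}
      & fps_coef S m = \sum_(t <- s) fps_coef (F t) m].

End FpsLimits.

(* cfrac_tail b a n d is                                                      *)
(*   b n - a n.+1 / (b n.+1 - a n.+2 / ( ... - a (n + d) / b (n + d))).       *)
Fixpoint cfrac_tail (K : comUnitRingType) (b a : nat -> K) (n d : nat) : K :=
  if d is d'.+1 then b n - a n.+1 / cfrac_tail b a n.+1 d' else b n.

(* For fps with constant term 1 in b and 0 in a, all denominators have        *)
(* constant term 1 and hence are units.                                       *)
Definition cfrac_trunc (K : comUnitRingType) (b a : nat -> K) (N : nat) : K :=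
  1 / cfrac_tail b a 0 N.

Section Patterns.
Variable n : nat.
Implicit Type s : 'S_n.

(* s contains the permutation whose one-line notation is p: f lists the       *)
(* positions of an occurrence.                                                *)
Definition contains (p : seq nat) s : bool :=
  [exists f : {ffun 'I_(size p) -> 'I_n},
    [forall i : 'I_(size p), forall j : 'I_(size p),
      ((i < j)%N ==> (f i < f j)%N) &&
      ((nth 0%N p i < nth 0%N p j)%N == (s (f i) < s (f j))%N)]].

Definition avoids (p : seq nat) s : bool := ~~ contains p s.

Definition is_involution s : bool := [forall i, s (s i) == i].

(* The number of decreasing subsequences of length k; a subsequence is given  *)
(* by its set of positions.                                                   *)
Definition tau (k : nat) s : nat :=
  #|[set A : {set 'I_n} |
      (#|A| == k) &&
      [forall i : 'I_n in A, forall j : 'I_n in A,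
         (i < j)%N ==> (s j < s i)%N]]|.

End Patterns.

Definition I3412 : {pred {n : nat & 'S_n}} :=
  [pred t | is_involution (tagged t) && avoids [:: 3; 4; 1; 2]%N (tagged t)].

Section Series.
Variable R : comNzRingType.

(* The indeterminate x_k, for k >= 1; the variables of fps nat R are indexed  *)
(* from 0.                                                                    *)
Definition x_ (k : nat) : fps nat R := fps_var R k.-1.

(* tau k s = 0 for k > n, so the product over all k >= 1 is finite.           *)
Definition weight (t : {n : nat & 'S_n}) : fps nat R :=
  \prod_(1 <= k < (tag t).+1) x_ k ^+ tau k (tagged t).

(* cf_a is used for n >= 1 only; see cf_b0 for n = 0 in cf_b.                 *)
Definition cf_a (n : nat) : fps nat R :=
  \prod_(1 <= i < (2 * n).+1)
    x_ i ^+ ('C(2 * n - 2, i - 1) + 'C(2 * n - 1, i - 1)).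

Definition cf_b (n : nat) : fps nat R :=
  1 - \prod_(1 <= i < (2 * n + 1).+1) x_ i ^+ 'C(2 * n, i - 1).

Lemma cf_b0 : cf_b 0 = 1 - x_ 1.
Proof. by rewrite /cf_b big_nat1 expr1. Qed.

End Series.

(* Main.v *)
From HB Require Import structures.
Require Import Defs.
From mathcomp Require Import all_boot all_algebra all_fingroup.
From mathcomp Require Import boolp monalg ring zify.

(** In a 3412-avoiding involution s of 0, .., n - 1, two arcs i < s i and
j < s j never cross: if 0 < i < s 0 < s i, the positions 0, i, s 0, s i form
a 3412. Hence s is either empty, or a fixed point followed by a smaller such
involution, or an arc enclosing one such involution and followed by another.
So these involutions are coded by Motzkin trees ([motzkin]), and the coding is
bijective ([motzkin_perm_inj], [motzkin_perm_I3412], [I3412_motzkin_perm]).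

Decreasing subsequences are the cliques of the inversion graph, and the
decomposition is transparent there. Juxtaposing two involutions takes the
disjoint union of the graphs, so the nonempty cliques of both are collected
([decpolyU]). Enclosing in an arc adds the two ends of the arc, each inverted
with everything else, and adding such a vertex multiplies the clique
polynomial, empty clique included, by 1 + 'X ([decpolyU1]). Therefore an
involution p enclosed in h arcs contributes, besides the cliques that avoid p
altogether, those counted by (1 + 'X) ^+ (2 * h) * q, where q counts the
nonempty cliques of p. Writing [motzkin_wt] h t for the corresponding monomial,
the generating function F h of these monomials over all trees t satisfies
  F h = 1 + w h * F h + a h.+1 * F h.+1 * F h,
where b = [cf_b], a = [cf_a], and where w h = 1 - b h and a h.+1 are the
contributions of a fixed point and of an arc at height h; this is F h = 1 / (b h - a h.+1 * F h.+1), whose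
iteration is the continued fraction, and F 0 is the sum over I(3412).

To keep all sums finite, F h is replaced by its restriction [partial_gf] h N to
the trees of depth at most N. It satisfies an exact recursion
([partial_gfS]); as w h and a h.+1 have no constant term, it is stationary in
degrees at most N ([partial_gf_stable]) and agrees there with the N-th
truncation of the fraction ([cfrac_tail_gf]). *)

Set Implicit Arguments.
Unset Strict Implicit.
Unset Printing Implicit Defensive.
Import GRing.Theory.
Local Open Scope ring_scope.

(** * Motzkin trees and 3412-avoiding involutions *)

(** Motzkin paths, split at the first return to the ground: [Level v] is a level
step followed by v, and [Arc u v] an up step, the raised path u, a down step,
and v. *)
Inductive motzkin := Empty | Level of motzkin | Arc of motzkin & motzkin.

HB.instance Definition _ := gen_eqMixin motzkin.

Fixpoint motzkin_size (t : motzkin) : nat :=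
  match t with
  | Empty => 0
  | Level v => 1 + motzkin_size v
  | Arc u v => (motzkin_size u).+2 + motzkin_size v
  end%N.

(** Direct sum of a permutation f of 0, .., p - 1 and a permutation g. *)
Definition dsum p (f g : nat -> nat) i : nat :=
  if (i < p)%N then f i else (g (i - p) + p)%N.

(** The permutation of 0, .., p + 1 that swaps its end points and acts on the
inner ones as a shifted copy of f. *)
Definition wrap p (f : nat -> nat) i : nat :=
  if i is i'.+1 then
    if (i' < p)%N then (f i').+1 else if i' == p then 0%N else i
  else p.+1.

Fixpoint motzkin_fun (t : motzkin) : nat -> nat :=
  match t with
  | Empty => id
  | Level v => dsum 1 id (motzkin_fun v)
  | Arc u v =>
    let p := motzkin_size u in
    dsum p.+2 (wrap p (motzkin_fun u)) (motzkin_fun v)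
  end.

(** Permutations are handled as functions on nat restricted to [0, n), so that
direct sums and restrictions need no casts between ordinal types. *)
Definition inv3412 n (f : nat -> nat) :=
  [/\ forall i, (i < n -> f i < n)%N,
      forall i, (i < n)%N -> f (f i) = i
    & forall i j k l, (i < j -> j < k -> k < l -> l < n ->
        f k < f l -> f l < f i -> f i < f j -> False)%N].

(** An occurrence i, j, k, l of 3412 lies in one summand. If i is in the second
one, so are the later positions; if i is in the first one, so are k and l, whose
values are below that of i, and j, which comes before k. *)
Lemma inv3412_dsum p q f g :
  inv3412 p f -> inv3412 q g -> inv3412 (p + q) (dsum p f g).
Proof.
move=> [fp fK fA] [gq gK gA]; rewrite /dsum; split.
- move=> i ip; case: (ltnP i p) => ip'; first by have := fp _ ip'; lia.
  by have := gq (i - p)%N; lia.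
- move=> i ip; case: (ltnP i p) => ip'; first by rewrite fp // fK.
  by rewrite ltnNge leq_addl /= addnK gK; lia.
- move=> i j k l ij jk kl lp; case: (ltnP i p) => ip.
    have fi := fp _ ip; case: (ltnP k p) => kp; last by lia.
    case: (ltnP l p) => lp'; last by lia.
    by rewrite (ltn_trans jk kp) => ? ? ?; apply: (fA i j k l).
  rewrite (leq_gtF (leq_trans ip (ltnW ij))).
  rewrite (leq_gtF (leq_trans ip (ltnW (ltn_trans ij jk)))).
  rewrite (leq_gtF (leq_trans ip (ltnW (ltn_trans ij (ltn_trans jk kl))))).
  rewrite !ltn_add2r => ? ? ?.
  by apply: (gA (i - p) (j - p) (k - p) (l - p))%N => //; lia.
Qed.

(** Neither end point takes part in an occurrence of 3412: the first position
carries the maximum and the last one the minimum, unlike the 3 and the 2. *)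
Lemma inv3412_wrap p f : inv3412 p f -> inv3412 p.+2 (wrap p f).
Proof.
move=> [fp fK fA]; rewrite /wrap; split.
- move=> [|i] ip //; case: (ltnP i p) => ip'; first by have := fp _ ip'; lia.
  by case: eqP => //; lia.
- move=> [|i] ip /=; first by rewrite ltnn eqxx.
  case: (ltnP i p) => ip'; first by rewrite fp // fK.
  by case: eqP => [->//|]; lia.
(* only position 0 takes the value p.+1, hence it cannot play the 3 *)
- have b i : (i < p.+1)%N ->
    ((if i < p then (f i).+1 else if i == p then 0 else i.+1) < p.+1)%N.
    move=> ip; case: (ltnP i p) => [/fp|]; first lia.
    by case: eqP; lia.
  move=> [|i] [|j] [|k] [|l] // ij jk kl lp; first by have := b j; lia.
  rewrite !ltnS in ij jk kl lp.
  case: (ltnP l p) => lp'; last by (have -> : l = p by lia); rewrite eqxx ltn0.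
  do 3![rewrite ifT; last lia].
  by rewrite !ltnS => *; apply: (fA i j k l).
Qed.

Lemma inv3412_motzkin_fun t : inv3412 (motzkin_size t) (motzkin_fun t).
Proof.
elim: t => [|v IH|u IHu v IHv] /=; first by split.
- by apply: inv3412_dsum => //; split=> // i j k l; lia.
- by apply: inv3412_dsum => //; apply: inv3412_wrap.
Qed.

(** The value at 0 tells the root constructor and the size of an enclosed
subtree, after which the subtrees are read off the two blocks. *)
Lemma motzkin_fun_inj t t' : motzkin_size t = motzkin_size t' ->
    (forall i, (i < motzkin_size t)%N -> motzkin_fun t i = motzkin_fun t' i) ->
  t = t'.
Proof.
elim: t t' => [|v IH|u IHu v IHv] [|v'|u' v'] //= nE fE.
- congr Level; apply: IH => [|i iv]; first lia.
  have := fE i.+1; rewrite /dsum /= subn1 /=; lia.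
- by have := fE 0%N; rewrite /dsum /=; lia.
- by have := fE 0%N; rewrite /dsum /=; lia.
have uE : motzkin_size u = motzkin_size u'.
  by have := fE 0%N; rewrite /dsum /=; lia.
congr Arc.
  apply: IHu => // i iu; have := fE i.+1; rewrite /dsum /= -uE iu !ifT; lia.
apply: IHv => [|i iv]; first lia.
have := fE ((motzkin_size u).+2 + i)%N.
rewrite /dsum /= -uE ![(_ + i < _)%N]ltnNge leq_addr /= addKn; lia.
Qed.

(** An arc from 0 to f 0 = p + 1 cannot be crossed, so that f preserves both
the block 1, .., p and the block following p + 1; each of them is again a
3412-avoiding involution after shifting. *)
Lemma motzkin_fun_surj n f : inv3412 n f ->
  exists2 t, motzkin_size t = n & forall i, (i < n)%N -> motzkin_fun t i = f i.
Proof.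
elim/ltn_ind: n f => -[|n] IH f [fn fK fA]; first by exists Empty.
have fI i j : (i < n.+1 -> j < n.+1 -> f i = f j -> i = j)%N.
  by move=> iP jP fE; rewrite -[i]fK // -[j]fK // fE.
case f0: (f 0%N) => [|p].
  have fpos i : (0 < i < n.+1 -> 0 < f i)%N.
    by case/andP => i0 iP; rewrite lt0n; apply/eqP => fi; have := fI i 0%N; lia.
  have [|v vn vf] := IH n (ltnSn n) (fun i => (f i.+1).-1).
    split=> [i iP|i iP|i j k l *]; first by have := fn i.+1; lia.
      by rewrite prednK ?fK ?fpos.
    by apply: (fA i.+1 j.+1 k.+1 l.+1); have := fpos i.+1; have := fpos j.+1;
      have := fpos k.+1; have := fpos l.+1; lia.
  exists (Level v) => /= [|[|i] iP]; rewrite /dsum /= ?vn // subn1 vf //=.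
  by have := fpos i.+1; lia.
have pn : (p.+1 < n.+1)%N by rewrite -f0 fn.
have fp1 : f p.+1 = 0%N by rewrite -f0 fK.
(* the block under the arc: leaving it would make 0, i, p.+1, f i a 3412 *)
have fin i : (0 < i <= p -> 0 < f i <= p)%N.
  move=> /andP[i0 ip]; have ip' : (i < n.+1)%N by lia.
  have := fI i p.+1 ip'; have := fI i 0%N ip' => *.
  suff: ~ (p.+1 < f i)%N by lia.
  move=> ltp; apply: (fA 0%N i p.+1 (f i)) => //;
    by rewrite ?fn ?fK ?fp1 ?f0 //; lia.
have fout i : (p.+1 < i < n.+1 -> p.+1 < f i < n.+1)%N.
  move=> /andP[pi iP]; have := fI i 0%N iP; have := fI i p.+1 iP.
  by have := fn _ iP; have := fin (f i); rewrite fK //; lia.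
have [||u un uf] := IH p _ (fun i => (f i.+1).-1); first lia.
  split=> [i iP|i iP|i j k l *]; first by have := fin i.+1; lia.
    by have fi := fin i.+1; rewrite prednK ?fK //; lia.
  by apply: (fA i.+1 j.+1 k.+1 l.+1); have := fin i.+1; have := fin j.+1;
    have := fin k.+1; have := fin l.+1; lia.
have [||v vn vf] :=
  IH (n - p.+1)%N _ (fun i => f (i + p.+2) - p.+2)%N; first lia.
  split=> [i iP|i iP|i j k l *]; first by have := fout (i + p.+2)%N; lia.
    by have fi := fout (i + p.+2)%N; rewrite subnK ?fK; lia.
  by apply: (fA (i + p.+2) (j + p.+2) (k + p.+2) (l + p.+2))%N;
    have := fout (i + p.+2)%N; have := fout (j + p.+2)%N;
    have := fout (k + p.+2)%N; have := fout (l + p.+2)%N; lia.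
exists (Arc u v) => /= [|i iP]; first lia.
rewrite /dsum un; case: (ltnP i p.+2) => ip.
  case: i ip iP => [|i] //= ip iP.
  case: (ltnP i p) => ip'.
    by have fi := fin i.+1; rewrite uf // prednK //; lia.
  by rewrite ifT; [have -> : i = p by lia | lia].
rewrite vf; last lia.
by have fi := fout i; rewrite !subnK //; lia.
Qed.

Lemma motzkin_fun_lt t i :
  (i < motzkin_size t)%N -> (motzkin_fun t i < motzkin_size t)%N.
Proof. by case: (inv3412_motzkin_fun t) => H _ _; apply: H. Qed.

Definition motzkin_ord t (i : 'I_(motzkin_size t)) : 'I_(motzkin_size t) :=
  Ordinal (motzkin_fun_lt (ltn_ord i)).

Lemma motzkin_ordK t : involutive (@motzkin_ord t).
Proof.
move=> i; apply: val_inj => /=; case: (inv3412_motzkin_fun t) => _ + _; apply.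
exact: ltn_ord.
Qed.

Definition motzkin_perm t : {n & 'S_n} :=
  existT (fun n => 'S_n) (motzkin_size t) (perm (inv_inj (@motzkin_ordK t))).

Lemma motzkin_perm_inj : injective motzkin_perm.
Proof.
move=> t t' tE; have ext (s s' : {n & 'S_n}) : s = s' -> tag s = tag s' /\
   forall (i : 'I_(tag s)) (j : 'I_(tag s')), val i = val j ->
   val (tagged s i) = val (tagged s' j).
  by move=> ->; split=> // i j /val_inj ->.
have [/= nE pE] := ext _ _ tE; apply: motzkin_fun_inj => // i it.
have it' : (i < motzkin_size t')%N by rewrite -nE.
by have := pE (Ordinal it) (Ordinal it') erefl; rewrite !permE.
Qed.

Lemma containsP n (s : 'S_n) :
  reflect (exists i j k l : 'I_n,
    [/\ (i < j)%N, (j < k)%N & (k < l)%N] /\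
    [/\ (s k < s l)%N, (s l < s i)%N & (s i < s j)%N])
    (contains [:: 3; 4; 1; 2]%N s).
Proof.
apply: (iffP existsP) => [[f /forallP fP]|[i [j [k [l]]]]].
  have H (i j : 'I_4) := forallP (fP i) j.
  exists (f (inord 0 : 'I_4)), (f (inord 1 : 'I_4)).
  exists (f (inord 2 : 'I_4)), (f (inord 3 : 'I_4)).
  have := H (inord 0) (inord 1); have := H (inord 1) (inord 2).
  have := H (inord 2) (inord 3); have := H (inord 3) (inord 0).
  by rewrite !inordK //= =>
    /eqP <- /andP[-> /eqP <-] /andP[-> _] /andP[-> /eqP <-].
move=> [[ij jk kl] [skl sli sij]].
exists [ffun a : 'I_4 => nth l [:: i; j; k; l] a].
apply/forallP => -[[|[|[|[|a]]]] // ap];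
  apply/forallP => -[[|[|[|[|b]]]] // bp];
  rewrite !ffunE /=; lia.
Qed.

Lemma motzkin_perm_I3412 t : motzkin_perm t \in I3412.
Proof.
have [_ fK fA] := inv3412_motzkin_fun t.
rewrite inE /=; apply/andP; split.
  by apply/forallP => i; rewrite !permE motzkin_ordK.
apply/negP => /containsP[i [j [k [l [[ij jk kl]]]]]].
by rewrite !permE /= => -[]; apply: fA ij jk kl (ltn_ord l).
Qed.

Lemma I3412_motzkin_perm s : s \in I3412 -> exists t, s = motzkin_perm t.
Proof.
case: s => n s /andP[/= /forallP sK sA].
pose f i := if insub i is Some o then val (s o) else i.
have fE (o : 'I_n) : f o = s o by rewrite /f valK.
have fO i (ip : (i < n)%N) : f i = s (Ordinal ip) by rewrite -fE.
have [|t tn tf] := @motzkin_fun_surj n f.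
  split=> [i ip|i ip|i j k l ij jk kl lp].
  - by rewrite fO.
  - by rewrite (fO _ ip) fE (eqP (sK _)).
  have kp := ltn_trans kl lp; have jp := ltn_trans jk kp.
  have ip := ltn_trans ij jp.
  rewrite !fO => *; case/negP: sA; apply/containsP.
  by exists (Ordinal ip), (Ordinal jp), (Ordinal kp), (Ordinal lp).
exists t; rewrite /motzkin_perm.
case: n / tn s sK sA f fE fO tf => s _ _ f fE _ tf.
congr existT; apply/permP => i; apply: val_inj.
by rewrite permE /= tf // fE.
Qed.

(** The trees of depth at most N. Bounding the depth rather than the size makes
the recursion of [partial_gfS] exact. *)
Fixpoint trees N : seq motzkin :=
  if N is N'.+1 then
    Empty :: map Level (trees N') ++
             [seq Arc u v | u <- trees N', v <- trees N']
  else [:: Empty].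

Lemma trees_uniq N : uniq (trees N).
Proof.
elim: N => [|N IH] //=; rewrite mem_cat negb_or cat_uniq.
rewrite map_inj_uniq ?IH => [|u v [] //].
rewrite allpairs_uniq // => [|[u v] [u' v'] _ _ [-> ->]//].
rewrite andbT /=; apply/andP; split.
- by apply/andP; split; [apply/mapP => -[]|apply/allpairsP => -[[u v] []]].
- by apply/hasPn => t /allpairsP[[u v] [_ _ ->]]; apply/mapP => -[].
Qed.

Lemma mem_trees t N : (motzkin_size t <= N)%N -> t \in trees N.
Proof.
elim: N t => [|N IH] [|v|u v] //= tN; rewrite ?in_cons ?mem_cat ?eqxx //=;
  apply/orP; right; apply/orP.
  by left; rewrite map_f // IH.
right; apply/allpairsP; exists (u, v).
by split=> /=; rewrite ?IH //; lia.
Qed.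

(** * Decreasing subsequences *)

Section Decreasing.
Variables (n : nat) (f : nat -> nat).
Implicit Types (A B D : {set 'I_n}) (i j v : 'I_n).

Definition decreasing A : bool :=
  [forall i in A, forall j in A, (i < j)%N ==> (f j < f i)%N].

Lemma decreasingP A :
  reflect {in A &, forall i j, (i < j -> f j < f i)%N} (decreasing A).
Proof.
apply: (iffP forall_inP) => [H i j iA jA|H i iA].
  by move/forall_inP: (H i iA) => /(_ j jA)/implyP.
by apply/forall_inP => j jA; apply/implyP; apply: H.
Qed.

(** The clique polynomial, without its constant term, of the inversion graph of
f on D. The empty set is left out so that disjoint unions become sums. *)
Definition decpoly D : {poly nat} :=
  \sum_(A : {set 'I_n} | [&& A != set0, A \subset D & decreasing A]) 'X^#|A|.

Lemma decpoly0 : decpoly set0 = 0.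
Proof.
by rewrite /decpoly big_pred0 // => A; rewrite subset0 andbA andNb.
Qed.

(** No element of D1 is inverted with an element of D2, hence a nonempty
decreasing set lies on one side only. *)
Lemma decpolyU D1 D2 :
    {in D1 & D2, forall i j, (i < j)%N && (f i < f j)%N} ->
  decpoly (D1 :|: D2) = decpoly D1 + decpoly D2.
Proof.
move=> D12; rewrite /decpoly (bigID (fun A => A \subset D1)) /=.
have H A i j :
    decreasing A -> i \in A -> j \in A -> i \in D1 -> j \in D2 -> False.
  move=> /decreasingP dA iA jA iD jD; have /andP[ij fij] := D12 i j iD jD.
  by have := dA _ _ iA jA ij; rewrite ltnNge ltnW.
congr (_ + _); apply: eq_bigl => A; have [//|A0 /=] := eqVneq A set0.
  case dA: (decreasing A); last by rewrite !andbF.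
  rewrite !andbT andb_idl // => AD; exact: subset_trans AD (subsetUl _ _).
case dA: (decreasing A); last by rewrite !andbF.
rewrite !andbT; apply/andP/idP => [[AD /subsetPn[j jA jD]]|AD].
  have jD2 : j \in D2 by move/subsetP: AD => /(_ j jA); rewrite inE (negPf jD).
  apply/subsetP => i iA; have:= subsetP AD i iA; rewrite inE => /orP[|//] iD.
  by case: (H A i j).
split; first exact: subset_trans AD (subsetUr _ _).
have /set0Pn[i iA] := A0; apply/negP => AD1.
have iD1 := subsetP AD1 i iA; have iD2 := subsetP AD i iA.
by case: (H A i i).
Qed.

(** As v is inverted with all of D, adding v to a decreasing subset of D keeps it
decreasing; the summand 'X is the singleton of v. *)
Lemma decpolyU1 v D :
    {in D, forall i,
       ((i < v)%N && (f v < f i)%N) || ((v < i)%N && (f i < f v)%N)} ->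
  decpoly (v |: D) = (1 + 'X) * decpoly D + 'X.
Proof.
move=> vD; have vD' : v \notin D.
  by apply/negP => /vD; rewrite ltnn.
rewrite /decpoly (bigID (fun A => v \in A)) /= mulrDl mul1r addrC -addrA.
congr (_ + _).
  apply: eq_bigl => A; rewrite -!andbA; congr (_ && _).
  rewrite andbCA [RHS]andbC; congr (_ && _); apply/andP/idP => [[vA]|AD].
    by rewrite -(setU1K vD') subsetD1 vA.
  split; last by apply: contra vD'; apply: subsetP.
  exact: subset_trans AD (subsetUr _ _).
rewrite (reindex_onto (fun A => v |: A) (fun A => A :\ v)) /=; last first.
  by move=> A /andP[_ vA]; rewrite setD1K.
have vA A : ((v |: A) :\ v == A) = (v \notin A).
  apply/eqP/idP => [<-|vA]; first by rewrite !inE eqxx.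
  by rewrite setU1K.
(* the sets containing v are the sets v |: A, and A = set0 is counted apart *)
rewrite (bigID (fun A => A == set0)) /= addrC; congr (_ + _); last first.
  rewrite (big_pred1 set0) => [|A]; first by rewrite setU0 cards1.
  rewrite /=; have [->|//] := eqVneq A set0; rewrite ?andbF //=.
  rewrite vA in_set0 setU11 setU0 !andbT.
  apply/and3P; split; rewrite ?sub1set ?setU11 //.
    by apply/set0Pn; exists v; rewrite inE.
  by apply/decreasingP => i j; rewrite !inE => /eqP -> /eqP ->; rewrite ltnn.
rewrite mulr_sumr; apply: eq_big => [A|A].
  rewrite vA setU11 andbT andbC; have [//|A0 /=] := eqVneq A set0.
  have -> : v |: A != set0 by apply/set0Pn; exists v; rewrite setU11.
  rewrite /= subUset sub1set setU11 /= -andbA.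
  apply/and3P/andP => [[AvD dA vA']|[AD dA]].
    split; first by rewrite -(setU1K vD') subsetD1 AvD.
    apply/decreasingP => i j iA jA.
    by apply: (decreasingP _ dA); rewrite inE ?iA ?jA orbT.
  split; last by apply: contra vD'; apply: subsetP.
    exact: subset_trans AD (subsetUr _ _).
  apply/decreasingP => i j; rewrite !inE => /orP[/eqP->|iA] /orP[/eqP->|jA].
  - by rewrite ltnn.
  - by have := vD _ (subsetP AD _ jA); lia.
  - by have := vD _ (subsetP AD _ iA); lia.
  - exact: (decreasingP _ dA).
by rewrite vA => /andP[/andP[_ vA'] _]; rewrite cardsU1 vA' exprS.
Qed.

End Decreasing.

(** The polynomial [decpoly] of the permutation coded by t, as given by
[decpolyU] and [decpolyU1], the latter used for both ends of an arc. The middle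
term of an arc is (1 + 'X) ^+ 2 - 1, written without subtraction and split as
the exponents of [cf_a] are. *)
Fixpoint motzkin_poly (t : motzkin) : {poly nat} :=
  match t with
  | Empty => 0
  | Level v => 'X + motzkin_poly v
  | Arc u v =>
    (1 + 'X) ^+ 2 * motzkin_poly u + ('X + 'X * (1 + 'X)) + motzkin_poly v
  end.

Definition itv n a b : {set 'I_n} := [set i : 'I_n | (a <= i < b)%N].

(** The tree may sit anywhere in a larger permutation, which lets the induction
descend to subtrees without transporting sets of positions. *)
Lemma decpoly_motzkin t n (f : nat -> nat) a : (a + motzkin_size t <= n)%N ->
    (forall i, (i < motzkin_size t)%N ->
       f (a + i)%N = (a + motzkin_fun t i)%N) ->
  decpoly f (itv n a (a + motzkin_size t)) = motzkin_poly t.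
Proof.
elim: t a => [|v IH|u IHu v IHv] a /= an fE.
- rewrite -[RHS](decpoly0 n f); congr decpoly.
  by apply/setP => i; rewrite !inE; lia.
- have ap : (a < n)%N by lia.
  rewrite -(IH a.+1) => [||i it]; [|lia|]; last first.
    by rewrite addSnnS fE // /dsum /= subn1 /=; lia.
  have -> : itv n a (a + (1 + motzkin_size v)) =
            (Ordinal ap |: set0) :|: itv n a.+1 (a.+1 + motzkin_size v).
    by apply/setP => i; rewrite !inE -val_eqE /=; lia.
  rewrite decpolyU => [|i j].
    by rewrite decpolyU1 ?decpoly0 ?mulr0 ?add0r // => i; rewrite inE.
  rewrite !inE orbF => /eqP -> /= /andP[aj jb]; rewrite aj /=.
  have fa : f a = a by rewrite -{1}[a]addn0 fE ?addn0.
  have -> : (j : nat) = (a + (j - a))%N by lia.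
  rewrite fE /dsum; last lia.
  by rewrite ifF ?fa; lia.
set p := motzkin_size u in an fE *; set r := motzkin_size v in an fE *.
have ap : (a < n)%N by lia.
have bp : (a + p.+1 < n)%N by lia.
have fa : f a = (a + p.+1)%N by rewrite -{1}[a]addn0 fE.
have fb : f (a + p.+1)%N = a.
  by rewrite fE; [rewrite /dsum /= leqnn ltnn eqxx addn0 | lia].
have fu i : (i < p)%N -> f (a.+1 + i)%N = (a.+1 + motzkin_fun u i)%N.
  by move=> ip; rewrite addSnnS fE; [rewrite /dsum /= ip ifT; lia | lia].
have fv i : (i < r)%N -> f (a + p.+2 + i)%N = (a + p.+2 + motzkin_fun v i)%N.
  move=> ir; rewrite -addnA fE ?/dsum; last lia.
  by rewrite ![(_ + i < _)%N]ltnNge leq_addr /= addKn; lia.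
rewrite -(IHu a.+1) //; last by rewrite -/p; lia.
rewrite -(IHv (a + p.+2)%N) //; last by rewrite -/r; lia.
rewrite -/p -/r.
have -> : itv n a (a + (p.+2 + r)) =
    (Ordinal ap |: (Ordinal bp |: itv n a.+1 (a.+1 + p)))
    :|: itv n (a + p.+2) (a + p.+2 + r).
  by apply/setP => i; rewrite !inE -!val_eqE /=; lia.
have inu i : (a < i < a + p.+1)%N -> (a < f i < a + p.+1)%N.
  move=> H; have -> : i = (a.+1 + (i - a.+1))%N by lia.
  by have := @motzkin_fun_lt u (i - a.+1); rewrite fu; lia.
have inv i : (a + p.+2 <= i < a + p.+2 + r)%N -> (a + p.+2 <= f i)%N.
  move=> H; have -> : i = (a + p.+2 + (i - (a + p.+2)))%N by lia.
  by rewrite fv; lia.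
rewrite decpolyU => [|i j].
  rewrite decpolyU1 => [|i].
    rewrite decpolyU1 => [|i]; first by ring.
    by rewrite !inE /= fb => ?; have := inu i; lia.
  rewrite !inE -val_eqE /= fa => /orP[/eqP ->|]; first by rewrite fb; lia.
  by move=> ?; have := inu i; lia.
rewrite !inE -!val_eqE /= => ipos jpos; have := inv j jpos; have := inu i.
by case/or3P: ipos => [/eqP ->|/eqP ->|]; rewrite ?fa ?fb; lia.
Qed.

Lemma tau_motzkin_perm t k :
  (0 < k)%N -> tau k (tagged (motzkin_perm t)) = (motzkin_poly t)`_k.
Proof.
move=> k0; rewrite -(@decpoly_motzkin t (motzkin_size t) (motzkin_fun t) 0) //.
rewrite /decpoly coef_sum add0n.
under eq_bigr do rewrite coefXn mulrb.
rewrite -big_mkcondr /= /tau cardsE -sum1_card; apply: eq_big => // A.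
rewrite unfold_in /=.
have -> : itv (motzkin_size t) 0 (motzkin_size t) = setT.
  by apply/setP => i; rewrite !inE ltn_ord.
rewrite subsetT -cards_eq0 [k == _]eq_sym.
have [->|_] := eqVneq #|A| k; last by rewrite andbF.
rewrite -lt0n k0 andbT /=.
apply: eq_forallb => i; congr (_ ==> _).
by apply: eq_forallb => j; rewrite !permE.
Qed.

Lemma size_motzkin_poly t : (size (motzkin_poly t) <= (motzkin_size t).+1)%N.
Proof.
apply/leq_sizeP => k tk; rewrite -tau_motzkin_perm; last exact: leq_trans tk.
apply/eqP; rewrite /tau cards_eq0; apply/eqP/setP => A; rewrite !inE.
apply/negP => /andP[/eqP Ak _]; have := max_card (mem A).
by rewrite Ak card_ord leqNgt tk.
Qed.

Lemma coef01_motzkin_poly t :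
  (motzkin_poly t)`_0 = 0%N /\ (motzkin_poly t)`_1 = motzkin_size t.
Proof.
elim: t => [|v [v0 v1]|u [u0 u1] v [v0 v1]] /=; first by rewrite !coef0.
  by rewrite !coefD !coefX v0 v1.
rewrite expr2 -mulrA !(mulrDl, mulrDr, mul1r, mulr1) !(coefD, coefXM) /=.
by rewrite !coefX !u0 u1 v0 v1 /= ?coefXM /= ?u0; split=> //; lia.
Qed.

(** * Power series of high order *)

Section Order.
Variables (I : choiceType) (R : comNzRingType).
Implicit Types (f g : fps I R) (m : {cmonom I}).

(** Stated for f - g, this is the congruence of f and g below total degree N. *)
Definition fps_order_ge N f := forall m, (mdeg m < N)%N -> fps_coef f m = 0.

Lemma order_ge_leq N M f : (N <= M)%N -> fps_order_ge M f -> fps_order_ge N f.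
Proof. by move=> NM fM m mN; apply: fM; apply: leq_trans NM. Qed.

Lemma order_geD N f g :
  fps_order_ge N f -> fps_order_ge N g -> fps_order_ge N (f + g).
Proof. by move=> fN gN m mN; rewrite /= fN ?gN ?addr0. Qed.

Lemma order_geN N f : fps_order_ge N f -> fps_order_ge N (- f).
Proof. by move=> fN m mN; rewrite /= fN ?oppr0. Qed.

Lemma order_ge_eq N f g m :
  fps_order_ge N (f - g) -> (mdeg m < N)%N -> fps_coef f m = fps_coef g m.
Proof. by move=> fg /fg /= /eqP; rewrite subr_eq0 => /eqP. Qed.

Lemma order_geM N M f g :
  fps_order_ge N f -> fps_order_ge M g -> fps_order_ge (N + M) (f * g).
Proof.
move=> fN gM m mNM /=; rewrite big_seq big1 // => -[d e] /=.
rewrite mem_mfactors /= => /eqP mE; move: mNM; rewrite -mE mdegM => mNM.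
have [dN|Nd] := ltnP (mdeg d) N; first by rewrite fN ?mul0r.
by rewrite gM ?mulr0 //; lia.
Qed.

Lemma order_geMl N f g : fps_order_ge N g -> fps_order_ge N (f * g).
Proof. by move=> gN; rewrite -[N]add0n; apply: order_geM. Qed.

Lemma order_geX N n f : fps_order_ge N f -> fps_order_ge (N * n) (f ^+ n).
Proof.
move=> fN; elim: n => [|n IH]; first by rewrite muln0.
by rewrite mulnS exprS; apply: order_geM.
Qed.

Lemma order_ge_var i : fps_order_ge 1 (fps_var R i).
Proof.
move=> m; rewrite ltnS leqn0 => /eqP m0 /=.
by case: eqP => // mE; move: m0; rewrite mE mdegU.
Qed.

Lemma fps_coef_sum (T : Type) (s : seq T) (F : T -> fps I R) m :
  fps_coef (\sum_(t <- s) F t) m = \sum_(t <- s) fps_coef (F t) m.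
Proof. by elim/big_rec2: _ => //= t x y _ <-. Qed.

(** With g = 1 - f, the inverse is the geometric series in g: its coefficients of
degree d are those of the partial sum of the powers up to d. *)
Lemma order_ge1_unit f : fps_order_ge 1 (1 - f) -> f \is a GRing.unit.
Proof.
move=> f1; pose g := 1 - f; pose P n := \sum_(0 <= i < n) g ^+ i.
have PE n : P n * f = 1 - g ^+ n.
  have -> : f = 1 - g by rewrite opprB addrC subrK.
  elim: n => [|n IH]; first by rewrite /P big_nil mul0r expr0 subrr.
  by rewrite /P big_nat_recr //= mulrDl IH exprS; ring.
have gn n : fps_order_ge n (g ^+ n).
  by have := order_geX (n := n) f1; rewrite mul1n.
pose S := FPS (fun m => fps_coef (P (mdeg m).+1) m).
have SP N : fps_order_ge N (S - P N).
  move=> m mN; apply/eqP; rewrite /= subr_eq0; apply/eqP.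
  rewrite /P !fps_coef_sum [RHS](big_cat_nat (n := (mdeg m).+1)) //=.
  rewrite [X in _ + X]big_nat_cond [X in _ + X]big1 ?addr0 //.
  move=> i /andP[/andP[mi _] _].
  exact: gn.
apply: (fps_unitPl (g := S)); apply/fpsP => m; set N := (mdeg m).+1.
apply: (@order_ge_eq N) => //.
have -> : S * f - 1 = f * (S - P N) + - g ^+ N.
  by rewrite mulrBr [f * P N]mulrC PE; ring.
by apply: order_geD; [apply: order_geMl | apply: order_geN].
Qed.

End Order.

(** * Monomials and the terms of the continued fraction *)

Section Monomials.
Variable R : comNzRingType.
Implicit Types p q : {poly nat}.

(** The coefficient of degree 0 is ignored, as the indeterminates start at x_1. *)
Definition mon p : fps nat R := \prod_(1 <= k < (size p).+1) x_ R k ^+ (p`_k)%R.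

(** Any bound on the degree will do, so that products of monomials and products
given over an explicit range can be compared factor by factor. *)
Lemma monE B p : (size p <= B.+1)%N ->
  mon p = \prod_(1 <= k < B.+1) x_ R k ^+ (p`_k)%R.
Proof.
have H a b : (a <= b)%N -> (size p <= a.+1)%N ->
    \prod_(1 <= k < a.+1) x_ R k ^+ (p`_k)%R =
    \prod_(1 <= k < b.+1) x_ R k ^+ (p`_k)%R.
  move=> ab pa; rewrite [RHS](big_cat_nat (n := a.+1)) //=.
  rewrite [X in _ * X]big_nat_cond [X in _ * X]big1 ?mulr1 //.
  move=> k /andP[/andP[ak _] _].
  by rewrite nth_default ?expr0 // (leq_trans pa).
move=> pB; rewrite /mon; have [/H->//|/ltnW Bp] := leqP (size p) B.
by rewrite [RHS](H _ _ Bp).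
Qed.

Lemma mon0 : mon 0 = 1.
Proof. by rewrite /mon size_poly0 big_geq. Qed.

Lemma monD p q : mon (p + q) = mon p * mon q.
Proof.
pose B := maxn (size p) (size q).
have Bp : (size p <= B.+1)%N by rewrite leqW // leq_maxl.
have Bq : (size q <= B.+1)%N by rewrite leqW // leq_maxr.
rewrite (monE Bp) (monE Bq) (@monE B) => [|]; last first.
  by rewrite (leq_trans (size_polyD _ _)) // leqW.
by rewrite -big_split; apply: eq_bigr => k _; rewrite coefD exprD.
Qed.

(** The exponent of x_1 alone gives the bound. *)
Lemma order_ge_mon p : fps_order_ge (p`_1)%R (mon p).
Proof.
have [->|p0] := eqVneq p 0; first by rewrite coef0.
rewrite /mon big_ltn ?ltnS ?lt0n ?size_poly_eq0 // mulrC.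
apply: order_geMl; rewrite -[X in fps_order_ge X]mul1n.
exact/order_geX/order_ge_var.
Qed.

Lemma coef_1DXn n k : ((1 + 'X) ^+ n : {poly nat})`_k = 'C(n, k).
Proof.
elim: n k => [|n IH] [|k]; rewrite ?expr0 ?coef1 //.
  by rewrite exprS mulrDl mul1r coefD coefXM addr0 IH bin0.
by rewrite exprS mulrDl mul1r coefD coefXM !IH binS.
Qed.

(** What a fixed point under h arcs contributes to [motzkin_wt]. *)
Definition level_wt h := mon ((1 + 'X) ^+ (2 * h) * 'X).

Lemma cf_bE h : cf_b R h = 1 - level_wt h.
Proof.
rewrite /cf_b /level_wt (@monE (2 * h + 1)) => [|].
  congr (1 - _); rewrite !big_nat; apply: eq_bigr => -[|i] // _.
  by rewrite coefMX /= coef_1DXn subn1.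
apply/leq_sizeP => -[|i] // ij.
by rewrite coefMX /= coef_1DXn bin_small //; lia.
Qed.

(** What the two ends of an arc at height h contribute: the exponents of [cf_a]
are the coefficients of (1 + 'X) ^+ (2 * h) times (1 + 'X) ^+ 2 - 1, with the
latter written as 'X + 'X * (1 + 'X). *)
Lemma cf_aE h :
  cf_a R h.+1 = mon ((1 + 'X) ^+ (2 * h) * ('X + 'X * (1 + 'X))).
Proof.
have -> : (1 + 'X) ^+ (2 * h) * ('X + 'X * (1 + 'X)) =
  ((1 + 'X) ^+ (2 * h) + (1 + 'X) ^+ (2 * h).+1) * 'X :> {poly nat}.
  by rewrite exprS; ring.
rewrite (@monE (2 * h.+1)) => [|].
  rewrite /cf_a !big_nat; apply: eq_bigr => -[|i] // _.
  rewrite coefMX /= coefD !coef_1DXn subn1.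
  by congr (_ ^+ ('C(_, _) + 'C(_, _))); lia.
apply/leq_sizeP => -[|i] // ij.
by rewrite coefMX /= coefD !coef_1DXn !bin_small //; lia.
Qed.

Lemma order_ge_level h : fps_order_ge 1 (level_wt h).
Proof.
have := @order_ge_mon ((1 + 'X) ^+ (2 * h) * 'X).
by rewrite coefMX coef_1DXn bin0.
Qed.

Lemma order_ge_cf_a h : fps_order_ge 1 (cf_a R h.+1).
Proof.
rewrite cf_aE mulrDr monD mulrC; exact/order_geMl/order_ge_level.
Qed.

Lemma weight_motzkin_perm t : weight R (motzkin_perm t) = mon (motzkin_poly t).
Proof.
rewrite (monE (size_motzkin_poly t)) /weight !big_nat.
by apply: eq_bigr => k /andP[k0 _]; rewrite tau_motzkin_perm.
Qed.

(** Since tau 1 is the length, only permutations of length at most d contribute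
in degree d; this makes the family of weights summable. *)
Lemma order_ge_weight t :
  fps_order_ge (motzkin_size t) (weight R (motzkin_perm t)).
Proof.
rewrite weight_motzkin_perm -(coef01_motzkin_poly t).2; exact: order_ge_mon.
Qed.

(** The weight of t placed under h arcs, counting only the decreasing sets that
meet t. *)
Definition motzkin_wt h t := mon ((1 + 'X) ^+ (2 * h) * motzkin_poly t).

Lemma motzkin_wt_Empty h : motzkin_wt h Empty = 1.
Proof. by rewrite /motzkin_wt mulr0 mon0. Qed.

Lemma motzkin_wt_Level h v :
  motzkin_wt h (Level v) = level_wt h * motzkin_wt h v.
Proof. by rewrite /motzkin_wt /= mulrDr monD. Qed.

Lemma motzkin_wt_Arc h u v :
  motzkin_wt h (Arc u v) = cf_a R h.+1 * motzkin_wt h.+1 u * motzkin_wt h v.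
Proof.
rewrite /motzkin_wt cf_aE -!monD; congr mon => /=.
by rewrite mulnS exprD; ring.
Qed.

Definition partial_gf h N := \sum_(t <- trees N) motzkin_wt h t.

Lemma partial_gf0 h : partial_gf h 0 = 1.
Proof. by rewrite /partial_gf big_seq1 motzkin_wt_Empty. Qed.

Lemma partial_gfS h N :
  partial_gf h N.+1 = 1 + level_wt h * partial_gf h N
                      + cf_a R h.+1 * partial_gf h.+1 N * partial_gf h N.
Proof.
rewrite /partial_gf /= big_cons big_cat big_map big_allpairs_dep /=.
rewrite motzkin_wt_Empty -addrA; congr (_ + (_ + _)).
  by rewrite mulr_sumr; apply: eq_bigr => v _; rewrite motzkin_wt_Level.
rewrite -mulrA big_distrlr mulr_sumr /=; apply: eq_bigr => u _.
rewrite mulr_sumr; apply: eq_bigr => v _.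
by rewrite motzkin_wt_Arc mulrA.
Qed.

(** By [partial_gfS] the difference of consecutive terms is a combination, with
coefficients [level_wt] and [cf_a] of positive order, of the previous
differences. *)
Lemma partial_gf_step h N :
  fps_order_ge N.+1 (partial_gf h N.+1 - partial_gf h N).
Proof.
elim: N h => [|N IH] h.
  rewrite partial_gfS !partial_gf0 !mulr1 -[1 + _ + _]addrA [1 + _]addrC addrK.
  by apply: order_geD; [exact: order_ge_level | exact: order_ge_cf_a].
rewrite partial_gfS [X in _ - X]partial_gfS.
set P := partial_gf h N.+1; set P' := partial_gf h.+1 N.+1.
set Q := partial_gf h N; set Q' := partial_gf h.+1 N; set a := cf_a _ _.
have -> : 1 + level_wt h * P + a * P' * P - (1 + level_wt h * Q + a * Q' * Q) =
  level_wt h * (P - Q) + a * (P' * (P - Q) + Q * (P' - Q')) by ring.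
apply: order_geD; first exact: (order_geM (@order_ge_level h) (IH h)).
apply: (order_geM (@order_ge_cf_a h)).
by apply: order_geD; apply: order_geMl; apply: IH.
Qed.

Lemma partial_gf_stable h N M : (N <= M)%N ->
  fps_order_ge N.+1 (partial_gf h M - partial_gf h N).
Proof.
move=> /subnK <-; elim: (M - N)%N => [|d IH]; first by rewrite subrr.
rewrite addSn -[X in X - _](subrK (partial_gf h (d + N))) -addrA.
apply: order_geD IH; apply: order_ge_leq (@partial_gf_step _ _).
by rewrite ltnS leq_addl.
Qed.

(** Both sides unfold in the same way: if T' is the tail at h + 1, then T = 1 -
level_wt h - a / T', whereas [partial_gfS] expresses 1 through the partial
generating functions. The error 1 - T * P is thus a combination, with
coefficients of order at least 1, of errors of order at least d + 1. *)
Lemma cfrac_tail_gf h d (T := cfrac_tail (cf_b R) (cf_a R) h d) :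
  T \is a GRing.unit /\ fps_order_ge d.+1 (1 / T - partial_gf h d).
Proof.
rewrite {}/T; elim: d h => [|d IH] h.
  have b1 : fps_order_ge 1 (1 - cf_b R h).
    by rewrite cf_bE opprB addrC subrK; apply: order_ge_level.
  have bU := order_ge1_unit b1; split=> //=.
  rewrite partial_gf0 -{2}(mulVr bU) div1r -[X in X - _]mulr1 -mulrBr.
  exact: order_geMl.
have [T'U T'P] := IH h.+1; rewrite div1r in T'P.
set T := cfrac_tail _ _ _ _; set T' := cfrac_tail _ _ h.+1 d in T'U T'P.
have TE : T = 1 - level_wt h - cf_a R h.+1 * T'^-1 by rewrite -cf_bE.
have T1 : fps_order_ge 1 (1 - T).
  have -> : 1 - T = level_wt h + T'^-1 * cf_a R h.+1 by rewrite TE; ring.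
  apply: order_geD; first exact: order_ge_level.
  exact/order_geMl/order_ge_cf_a.
have TU := order_ge1_unit T1; split=> //.
pose P := partial_gf h d.+1; pose Q := partial_gf h d.
pose Q' := partial_gf h.+1 d.
have -> : 1 / T - P = T^-1 * (1 - T * P).
  by rewrite mulrBr mulrA mulVr // mulr1 !mul1r.
apply: order_geMl.
have -> : 1 - T * P =
    level_wt h * (P - Q) + cf_a R h.+1 * (T'^-1 * (P - Q) + Q * (T'^-1 - Q')).
  have PE : P = _ := partial_gfS h d.
  rewrite -/Q -/Q' in PE.
  rewrite TE !mulrBl mul1r {1}PE; ring.
apply: order_geD.
  exact: (order_geM (@order_ge_level h) (@partial_gf_step h d)).
apply: (order_geM (@order_ge_cf_a h)).
apply: order_geD; apply: order_geMl => //; exact: partial_gf_step.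
Qed.

End Monomials.

Theorem theorem3p3 (R : comNzRingType) :
  exists S : fps nat R,
    fps_has_sum (T := {n : nat & 'S_n}) I3412 (weight R) S /\
    fps_cvg (cfrac_trunc (cf_b R) (cf_a R)) S.
Proof.
(* The m-th coefficient is read off the trees of depth at most mdeg m, beyond *)
(* which it does not change. *)
exists (FPS (fun m => fps_coef (partial_gf R 0 (mdeg m)) m)); split=> m.
  exists (map motzkin_perm (trees (mdeg m))); split.
  - by rewrite map_inj_uniq ?trees_uniq //; apply: motzkin_perm_inj.
  - by move=> s /mapP[t _ ->]; apply: motzkin_perm_I3412.
  - move=> s /I3412_motzkin_perm[t ->] tN; apply: order_ge_weight.
    rewrite ltnNge; apply: contra tN => tN; exact/map_f/mem_trees.
  rewrite big_map /= fps_coef_sum; apply: eq_bigr => t _.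
  by rewrite weight_motzkin_perm /motzkin_wt muln0 expr0 mul1r.
exists (mdeg m) => N mN; have [_ gfN] := cfrac_tail_gf R 0 N.
transitivity (fps_coef (partial_gf R 0 N) m); first exact: (order_ge_eq gfN).
exact: (order_ge_eq (@partial_gf_stable R 0 _ _ mN)).
Qed.
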